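(* Let $p$ be an odd prime. For all $m, n, k \in \mathbb{Z}_+=\{0,1,2,\dots\}$ with $m+n > 2k$, $$\int_{\mathbb{Z}_p} B_{k,n}(x)B_{k,m}(x)\, d\mu_{-1}(x) = \begin{cases} 2+E_{n+m} & \text{if } k=0,\\[2mm] \displaystyle\binom{n}{k}\binom{m}{k}\sum_{j=0}^{2k}\binom{2k}{j}(-1)^{j+2k}E_{n+m-j} & \text{if } k>0.\end{cases}$$
   Context: For a uniformly differentiable function $f:\mathbb{Z}_p \to \mathbb{C}_p$ (in particular any polynomial), the fermionic $p$-adic invariant integral on $\mathbb{Z}_p$ is $$\int_{\mathbb{Z}_p} f(x)\, d\mu_{-1}(x) = \lim_{N\to\infty} \sum_{x=0}^{p^N-1} f(x)(-1)^x,$$ where the limit is taken in the $p$-adic topology. For $k,n\in\mathbb{Z}_+$ the Bernstein polynomial is $B_{k,n}(x) = \binom{n}{k} x^k (1-x)^{n-k}$ for $k \le n$, and $B_{k,n}(x)=0$ for $n<k$ (where $\binom{n}{k}=0$). The Euler numbers $E_n\in\mathbb{Q}$ ($n\ge 0$) are defined by $\frac{2}{e^t+1} = \sum_{n=0}^{\infty} E_n \frac{t^n}{n!}$ and are regarded as elements of $\mathbb{Q}_p$. *)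

(* Defs.v *)
(* MathComp / MathComp-Analysis *)
From HB Require Import structures.
From mathcomp Require Import all_boot all_order all_algebra.
From mathcomp Require Import boolp classical_sets functions filter topology.

Set Implicit Arguments.
Unset Strict Implicit.
Unset Printing Implicit Defensive.

Import Order.TTheory GRing.Theory Num.Theory.
Local Open Scope ring_scope.

(* Z_p is the inverse limit of the rings Z/p^n: an element is a sequence of
   residues [x n] in {0, ..., p^n - 1} with [x n.+1 = x n %[mod p ^ n]].  The
   index [p_pr] is only there so that the ring instances can use that p is
   prime. *)
Record padicint (p : nat) (p_pr : prime p) := PadicInt {
  pres :> nat -> nat;
  pres_ltn : forall n, (pres n < p ^ n)%N;
  pres_coh : forall n, (pres n.+1 %% p ^ n)%N = pres n }.

Section PadicIntRing.
Variables (p : nat) (p_pr : prime p).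
Local Notation Zp := (padicint p_pr).

Lemma padicint_eq (x y : Zp) : pres x =1 pres y -> x = y.
Proof.
case: x y => [x x1 x2] [y y1 y2] /= /funext exy; subst y.
by congr PadicInt; exact: Prop_irrelevance.
Qed.

HB.instance Definition _ := gen_eqMixin Zp.
HB.instance Definition _ := gen_choiceMixin Zp.

Lemma expp_gt0 n : (0 < p ^ n)%N.
Proof. by rewrite expn_gt0 prime_gt0. Qed.

Lemma pres_mod (x : Zp) m n : (m <= n)%N -> (x n %% p ^ m)%N = x m.
Proof.
move=> /subnK <-; elim: (n - m)%N => [|k IHk].
  by rewrite add0n modn_small ?pres_ltn.
rewrite -[RHS]IHk addSn -[in RHS](pres_coh x (k + m)).
by rewrite modn_dvdm // dvdn_exp2l // leq_addl.
Qed.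

Section Mk.
Variable f : nat -> nat.
Hypothesis f_coh : forall n, f n.+1 = f n %[mod p ^ n].
Fact mk_ltn n : (f n %% p ^ n < p ^ n)%N.
Proof. by rewrite ltn_mod expp_gt0. Qed.
Fact mk_coh n : ((f n.+1 %% p ^ n.+1) %% p ^ n)%N = (f n %% p ^ n)%N.
Proof. by rewrite modn_dvdm ?f_coh // dvdn_exp2l. Qed.
Definition mk_padicint : Zp :=
  @PadicInt p p_pr (fun n => f n %% p ^ n)%N mk_ltn mk_coh.
End Mk.

Fact padd_coh (x y : Zp) n : (x n.+1 + y n.+1 = x n + y n %[mod p ^ n])%N.
Proof. by rewrite -modnDm !pres_coh. Qed.
Fact pmul_coh (x y : Zp) n : (x n.+1 * y n.+1 = x n * y n %[mod p ^ n])%N.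
Proof. by rewrite -modnMm !pres_coh. Qed.
Fact popp_coh (x : Zp) n :
  (p ^ n.+1 - x n.+1 = p ^ n - x n %[mod p ^ n])%N.
Proof.
apply/eqP; rewrite -(eqn_modDr (x n.+1)) subnK; last exact/ltnW/pres_ltn.
rewrite -modnDmr pres_coh subnK; last exact/ltnW/pres_ltn.
by rewrite expnS modnMl modnn.
Qed.
Fact pnat_coh (k n : nat) : k = k %[mod p ^ n]. Proof. by []. Qed.

Definition padd (x y : Zp) := mk_padicint (padd_coh x y).
Definition pmul (x y : Zp) := mk_padicint (pmul_coh x y).
Definition popp (x : Zp) := mk_padicint (popp_coh x).
Definition pzero : Zp := mk_padicint (pnat_coh 0).
Definition pone : Zp := mk_padicint (pnat_coh 1).

Fact paddA : associative padd.
Proof. by move=> x y z; apply: padicint_eq => n /=; rewrite modnDml modnDmr addnA. Qed.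
Fact paddC : commutative padd.
Proof. by move=> x y; apply: padicint_eq => n /=; rewrite addnC. Qed.
Fact padd0 : left_id pzero padd.
Proof.
move=> x; apply: padicint_eq => n /=.
by rewrite mod0n add0n modn_small ?pres_ltn.
Qed.
Fact paddN : left_inverse pzero popp padd.
Proof.
move=> x; apply: padicint_eq => n /=.
by rewrite modnDml subnK ?modnn ?mod0n //; exact/ltnW/pres_ltn.
Qed.
HB.instance Definition _ := GRing.isZmodule.Build Zp paddA paddC padd0 paddN.

Fact pmulA : associative pmul.
Proof. by move=> x y z; apply: padicint_eq => n /=; rewrite modnMml modnMmr mulnA. Qed.
Fact pmulC : commutative pmul.
Proof. by move=> x y; apply: padicint_eq => n /=; rewrite mulnC. Qed.
Fact pmul1 : left_id pone pmul.
Proof.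
move=> x; apply: padicint_eq => n /=.
by rewrite modnMml mul1n modn_small ?pres_ltn.
Qed.
Fact pmulDl : left_distributive pmul padd.
Proof.
move=> x y z; apply: padicint_eq => n /=.
by rewrite modnMml modnDml modnDmr mulnDl.
Qed.
Fact pone_neq0 : pone != 0 :> Zp.
Proof.
apply/eqP => /(congr1 (fun x : Zp => x 1%N)) /=.
by rewrite mod0n expn1 modn_small // prime_gt1.
Qed.
HB.instance Definition _ :=
  GRing.Zmodule_isComNzRing.Build Zp pmulA pmulC pmul1 pmulDl pone_neq0.

Lemma pres0 n : (0 : Zp) n = 0%N.
Proof. exact: mod0n. Qed.
Lemma presM (x y : Zp) n : (x * y) n = (x n * y n %% p ^ n)%N.
Proof. by []. Qed.
Lemma presD (x y : Zp) n : (x + y) n = ((x n + y n) %% p ^ n)%N.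
Proof. by []. Qed.
Lemma pres_nat k n : (k%:R : Zp) n = (k %% p ^ n)%N.
Proof.
elim: k => [|k IHk]; first by rewrite pres0 mod0n.
by rewrite mulrS presD IHk /= modnDml modnDmr.
Qed.

Definition punit : {pred Zp} := fun x => `[< exists y : Zp, y * x = 1 >].
Definition pinv (x : Zp) : Zp := xget x [set y | y * x = 1]%classic.
Fact pmulV : {in punit, left_inverse 1 pinv *%R}.
Proof. by move=> x /asboolP[y yx]; rewrite /pinv; case: xgetP => [z _ //|/(_ y)]. Qed.
Fact punitP (x y : Zp) : y * x = 1 -> punit x.
Proof. by move=> yx; apply/asboolP; exists y. Qed.
Fact pinv_out : {in [predC punit], pinv =1 id}.
Proof.
move=> x /asboolPn Nx; rewrite /pinv; case: xgetP => [y _ yx|//].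
by case: Nx; exists y.
Qed.
HB.instance Definition _ :=
  GRing.ComNzRing_hasMulInverse.Build Zp pmulV punitP pinv_out.

Lemma pres_neq0 (x : Zp) : x != 0 -> exists n, ~~ (p ^ n %| x n)%N.
Proof.
move=> x0; apply: contrapT => xn; move/eqP: x0; apply; apply: padicint_eq => n.
rewrite pres0 -(pres_mod x (leqnn n)); apply/eqP.
by apply: contrapT => /negP px; apply: xn; exists n.
Qed.

Fact pmul_integral : GRing.integral_domain_axiom Zp.
Proof.
move=> x y xy0; apply: contrapT => /negP; rewrite negb_or => /andP[].
move=> /pres_neq0[a xa] /pres_neq0[b yb].
have := congr1 (fun z : Zp => z (a + b)%N) xy0.
rewrite presM pres0 => /eqP; rewrite -/(p ^ (a + b) %| _)%N.
have xa' : ~~ (p ^ a %| x (a + b))%N by rewrite /dvdn pres_mod ?leq_addr // -(pres_mod x (leqnn a)).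
have yb' : ~~ (p ^ b %| y (a + b))%N by rewrite /dvdn pres_mod ?leq_addl // -(pres_mod y (leqnn b)).
have x0 : (0 < x (a + b))%N by rewrite lt0n; apply: contraNneq xa' => ->.
have y0 : (0 < y (a + b))%N by rewrite lt0n; apply: contraNneq yb' => ->.
rewrite pfactor_dvdn ?muln_gt0 ?x0 // lognM //.
move: xa' yb'; rewrite !pfactor_dvdn // -!ltnNge => xa' yb'.
by rewrite leqNgt -addSn leq_add // ltnW.
Qed.
HB.instance Definition _ := GRing.ComUnitRing_isIntegral.Build Zp pmul_integral.

End PadicIntRing.

Lemma fraction_numden (R : idomainType) (x : {fraction R}) :
  exists a b : R, b != 0 /\ x * FracField.tofrac b = FracField.tofrac a.
Proof.
elim/quotW: x => x; exists (frac x).1, (frac x).2; split; first exact: denom_ratioP.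
rewrite !piE; apply/eqmodP; rewrite /= equivfE /FracField.mulf.
by rewrite !numden_Ratio ?mulr1 ?oner_neq0 ?denom_ratioP // mulrC.
Qed.

Definition padic (p : nat) (p_pr : prime p) : Type := {fraction padicint p_pr}.

HB.instance Definition _ p p_pr := GRing.Field.on (@padic p p_pr).
HB.instance Definition _ p p_pr := isPointed.Build (@padic p p_pr) 0.

Definition padic_of_int p (p_pr : prime p) (x : padicint p_pr) : padic p_pr :=
  FracField.tofrac x.

HB.instance Definition _ p p_pr :=
  GRing.RMorphism.copy (@padic_of_int p p_pr) (@FracField.tofrac (padicint p_pr)).

(* The subgroups p^N Z_p are the closed balls of radius p^-N around 0, hence a
   basis of neighbourhoods of 0 for the p-adic absolute value. *)
Definition padic_ball p (p_pr : prime p) (N : nat) : set (padic p_pr) :=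
  [set x | exists z : padicint p_pr, x = p%:R ^+ N * padic_of_int z]%classic.
Arguments padic_ball {p} p_pr N _.

Section PadicTopology.
Variables (p : nat) (p_pr : prime p).
Local Notation Zp := (padicint p_pr).
Local Notation Qp := (padic p_pr).
Local Open Scope classical_set_scope.
Local Open Scope relation_scope.

Definition padic_entourage : set_system (Qp * Qp) :=
  [set A | exists N, [set xy | padic_ball p_pr N (xy.1 - xy.2)] `<=` A].

Lemma padic_ball_le M N : (M <= N)%N -> padic_ball p_pr N `<=` padic_ball p_pr M.
Proof.
move=> MN _ [z ->]; exists (p%:R ^+ (N - M) * z).
by rewrite rmorphM rmorphXn rmorph_nat mulrA -exprD subnKC.
Qed.

Lemma padic_ballD N x y :
  padic_ball p_pr N x -> padic_ball p_pr N y -> padic_ball p_pr N (x + y).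
Proof. by move=> [z ->] [t ->]; exists (z + t); rewrite rmorphD mulrDr. Qed.

Lemma padic_ballN N x : padic_ball p_pr N x -> padic_ball p_pr N (- x).
Proof. by move=> [z ->]; exists (- z); rewrite rmorphN mulrN. Qed.

Fact padic_entourage_filter : Filter padic_entourage.
Proof.
split=> [|A B [M MA] [N NB]|A B AB [N NA]]; first by exists 0%N.
- exists (maxn M N) => xy /= h; split.
    by apply: MA; apply: padic_ball_le h; rewrite leq_maxl.
  by apply: NB; apply: padic_ball_le h; rewrite leq_maxr.
- by exists N; apply: subset_trans AB.
Qed.

Fact padic_entourage_diagonal A : padic_entourage A -> diagonal `<=` A.
Proof.
move=> [N NA] [x y] /= xy; apply: NA => /=; move: xy; rewrite /diagonal /= => ->.
by exists 0; rewrite subrr rmorph0 mulr0.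
Qed.

Fact padic_entourage_inv A : padic_entourage A -> padic_entourage A^-1.
Proof.
move=> [N NA]; exists N => -[x y] /= h; apply: NA => /=.
by rewrite -opprB; exact: padic_ballN.
Qed.

Fact padic_entourage_split A :
  padic_entourage A -> exists2 B, padic_entourage B & B \; B `<=` A.
Proof.
move=> [N NA]; exists [set xy | padic_ball p_pr N (xy.1 - xy.2)]; first by exists N.
move=> [x y] /= [z h1 h2]; apply: NA => /=.
by rewrite -(subrKA z); exact: padic_ballD.
Qed.

HB.instance Definition _ := isUniform.Build Qp padic_entourage_filter
  padic_entourage_diagonal padic_entourage_inv padic_entourage_split.

Lemma padic_natr_neq0 n : (0 < n)%N -> n%:R != 0 :> Qp.
Proof.
move=> n0; rewrite -(rmorph_nat (@padic_of_int p p_pr)) tofrac_eq0.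
apply/eqP => /(congr1 (fun x : Zp => x n)).
rewrite pres_nat pres0 modn_small; first by move=> n0'; rewrite n0' in n0.
by apply: ltn_expl; exact: prime_gt1.
Qed.

Lemma padic_of_int_inj : injective (@padic_of_int p p_pr).
Proof. by move=> x y /eqP; rewrite tofrac_eq => /eqP. Qed.

Lemma padic_fracP (x : Qp) :
  exists a b : Zp, b != 0 /\ x * padic_of_int b = padic_of_int a.
Proof. exact: fraction_numden. Qed.

Lemma padic_ball_bigcap (x : Qp) : (forall N, padic_ball p_pr N x) -> x = 0.
Proof.
move=> h; have [a [b [b0 xb]]] := padic_fracP x.
suff a0 : a = 0.
  apply/eqP; move/eqP: xb; rewrite a0 rmorph0 mulf_eq0 => /orP[//|].
  by rewrite tofrac_eq0 (negPf b0).
apply: padicint_eq => n; have [z xz] := h n.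
have : a = p%:R ^+ n * (z * b).
  by apply: padic_of_int_inj; rewrite -xb xz !rmorphM rmorphXn rmorph_nat mulrA.
move=> ->; rewrite -natrX presM pres_nat modnn mul0n mod0n pres0 //.
Qed.

Lemma padic_nbhsP (x : Qp) (A : set Qp) :
  nbhs x A <-> exists N, [set y | padic_ball p_pr N (y - x)] `<=` A.
Proof.
rewrite -nbhs_entourageE; split.
  move=> [B [N NB] BA]; exists N => y /= h; apply: BA; rewrite /xsection /= inE.
  by apply: NB; rewrite /= -opprB; exact: padic_ballN.
move=> [N NA]; exists [set xy | padic_ball p_pr N (xy.1 - xy.2)]; first by exists N.
move=> y; rewrite /xsection /= inE /= => h; apply: NA => /=.
by rewrite -opprB; exact: padic_ballN.
Qed.

Lemma padic_cvgP (u : nat -> Qp) (l : Qp) :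
  u @ \oo --> l <->
  forall N, exists M, forall n, (M <= n)%N -> padic_ball p_pr N (u n - l).
Proof.
split=> [ul N|h A /padic_nbhsP[N NA]].
  have /ul[M _ MN] : nbhs l [set y | padic_ball p_pr N (y - l)].
    by apply/padic_nbhsP; exists N.
  by exists M => n Mn; exact: (MN n Mn).
have [M hM] := h N; exists M => // n Mn; apply: NA; exact: (hM n Mn).
Qed.

Lemma padic_hausdorff : hausdorff_space Qp.
Proof.
move=> x y xy; apply/eqP; rewrite -subr_eq0; apply/eqP/padic_ball_bigcap => N.
have nb (z : Qp) : nbhs z [set t | padic_ball p_pr N (t - z)].
  by apply/padic_nbhsP; exists N.
have [t [/= tx ty]] := xy _ _ (nb x) (nb y).
rewrite -[x - y](subrKA t) addrC; apply: padic_ballD => //.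
by rewrite -opprB; exact: padic_ballN.
Qed.

End PadicTopology.

(* Integrands here are Q_p-valued; Q_p is closed in C_p, so the limit is the
   same whether taken in Q_p or in C_p. *)
Definition fermionic_sum p (p_pr : prime p) (f : padicint p_pr -> padic p_pr)
  (N : nat) : padic p_pr := \sum_(0 <= x < p ^ N) f x%:R * (-1) ^+ x.

Definition fermionic_integrable p (p_pr : prime p)
    (f : padicint p_pr -> padic p_pr) : Prop :=
  (cvg (fermionic_sum f @ \oo))%classic.

(* Only meaningful under [fermionic_integrable f]. *)
Definition fermionic_integral p (p_pr : prime p)
    (f : padicint p_pr -> padic p_pr) : padic p_pr :=
  (lim (fermionic_sum f @ \oo))%classic.

Definition bernstein (R : nzRingType) (k n : nat) : {poly R} :=
  if (k <= n)%N then 'C(n, k)%:R *: ('X^k * (1 - 'X) ^+ (n - k)) else 0.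

(* A formal power series over a field is given by its coefficient sequence. *)
Definition fps_mul (F : fieldType) (a b : nat -> F) (n : nat) : F :=
  \sum_(i < n.+1) a i * b (n - i)%N.

Fixpoint fps_inv_seq (F : fieldType) (a : nat -> F) (n : nat) : seq F :=
  if n is n'.+1 then
    let s := fps_inv_seq a n' in
    rcons s (- (a 0%N)^-1 * \sum_(i < n'.+1) a i.+1 * s`_(n' - i))
  else [:: (a 0%N)^-1].

(* The reciprocal 1/a of a power series with a 0 != 0; see [fps_mulV]. *)
Definition fps_inv (F : fieldType) (a : nat -> F) (n : nat) : F :=
  (fps_inv_seq a n)`_n.

Lemma size_fps_inv_seq (F : fieldType) (a : nat -> F) n :
  size (fps_inv_seq a n) = n.+1.
Proof. by elim: n => //= n IHn; rewrite size_rcons IHn. Qed.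

Lemma nth_fps_inv_seq (F : fieldType) (a : nat -> F) n i :
  (i <= n)%N -> (fps_inv_seq a n)`_i = fps_inv a i.
Proof.
elim: n => [|n IHn]; first by rewrite leqn0 => /eqP ->.
rewrite leq_eqVlt => /orP[/eqP -> //|lt_in] /=.
by rewrite nth_rcons size_fps_inv_seq lt_in IHn.
Qed.

Lemma fps_mulV (F : fieldType) (a : nat -> F) (a0 : a 0%N != 0) n :
  fps_mul a (fps_inv a) n = (n == 0%N)%:R.
Proof.
case: n => [|n]; first by rewrite /fps_mul big_ord1 /fps_inv /= divff.
rewrite /fps_mul big_ord_recl subn0 {1}/fps_inv /= nth_rcons size_fps_inv_seq.
rewrite ltnn eqxx mulrA mulrN divff // mulN1r.
rewrite [X in - X](eq_bigr (fun i : 'I_n.+1 => a i.+1 * fps_inv a (n - i)%N)).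
  by apply/eqP; rewrite addrC subr_eq0; apply/eqP/eq_bigr.
by move=> i _; rewrite nth_fps_inv_seq // leq_subr.
Qed.

(* The coefficients of e^t + 1. *)
Definition expt_add1 (n : nat) : rat := (n`!%:R)^-1 + (n == 0%N)%:R.

(* E_n / n! is the coefficient of t^n in 2 / (e^t + 1). *)
Definition euler (n : nat) : rat := n`!%:R * (2 * fps_inv expt_add1 n).

Lemma euler_gf n :
  fps_mul expt_add1 (fun i => euler i / i`!%:R) n = 2 * (n == 0%N)%:R.
Proof.
have a0 : expt_add1 0 != 0 by [].
rewrite -(fps_mulV a0) /fps_mul mulr_sumr; apply: eq_bigr => i _.
by rewrite /euler mulrAC mulfV ?mul1r 1?mulrCA // pnatr_eq0 -lt0n fact_gt0.
Qed.

(* Main.v *)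
(** Write [M = p ^ N], which is odd.  Telescoping gives
    [S (f (x + 1)) + S (f x) = f 0 + f M] for the alternating sum [S] over
    [0 <= x < M].  For [f x = (2 - x) ^ s], expanded in powers of [1 - x], this
    is a triangular recurrence for the moments [b_s = S ((1 - x) ^ s)] with
    right-hand side [2 ^ s + (2 - M) ^ s].  The numbers [2 + E_s - 2 [s = 0]]
    satisfy the same recurrence with [2 ^ (s + 1)] on the right, and since [2]
    is a unit of Z_p the two sequences agree modulo [p ^ N].  The theorem
    follows by expanding [x ^ (2 k) = (1 - (1 - x)) ^ (2 k)]; for [k > 0] the
    constants [2] cancel. *)
Require Import Defs.
From mathcomp Require Import all_boot all_order all_algebra.
From mathcomp Require Import boolp classical_sets filter topology.
From mathcomp Require Import ring zify.
Import GRing.Theory.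
Local Open Scope ring_scope.

(** * Rational numbers inside a field of characteristic zero *)

Section RatrChar0.
Variable F : fieldType.
Hypothesis F0 : forall n, (0 < n)%N -> n%:R != 0 :> F.

Lemma intr_neq0_char0 (z : int) : z != 0 -> z%:~R != 0 :> F.
Proof.
case: z => n; last by move=> _; rewrite NegzE mulrNz oppr_eq0; exact: F0.
by move=> n0; apply: F0; rewrite lt0n.
Qed.

(** [F] carries no order here; nonvanishing of the denominators is enough. Clearing them leaves an
    integer identity, checked in [rat], where the cast from [int] is injective. *)
Lemma ratrD_char0 : {morph @ratr F : x y / x + y}.
Proof.
have injZtoQ : injective (intr : int -> rat) := @intr_inj _.
have nz_den x : (denq x)%:~R != 0 :> F by rewrite intr_neq0_char0 ?denq_eq0.
move=> x y; apply: (canLR (mulfK (nz_den _))); apply: (mulIf (nz_den x)).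
rewrite mulrAC mulrDl divfK ?nz_den // mulrAC -!rmorphM.
apply: (mulIf (nz_den y)); rewrite mulrAC mulrDl divfK ?nz_den //.
rewrite -!(rmorphM, rmorphD); congr _%:~R; apply: injZtoQ.
by rewrite !(rmorphM, rmorphD) /= !numqE; ring.
Qed.

Lemma ratrM_char0 : {morph @ratr F : x y / x * y}.
Proof.
have injZtoQ : injective (intr : int -> rat) := @intr_inj _.
have nz_den x : (denq x)%:~R != 0 :> F by rewrite intr_neq0_char0 ?denq_eq0.
move=> x y; rewrite /ratr mulrC mulrAC; apply: canLR (mulKf (nz_den _)) _.
rewrite !mulrA; do 2!apply: canRL (mulfK (nz_den _)) _.
rewrite -!rmorphM; congr _%:~R; apply: injZtoQ.
by rewrite !rmorphM /= !numqE; ring.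
Qed.

End RatrChar0.

(** Compare coefficients of t^n in (e^t + 1) * (2 / (e^t + 1)) = 2 and multiply by n!. The factor
    e^t produces the binomial sum, the constant 1 the extra [euler n]. *)
Lemma euler_rec n :
  euler n + \sum_(i < n.+1) euler i *+ 'C(n, i) = 2 * (n == 0%N)%:R.
Proof.
have fact_neq0 j : j`!%:R != 0 :> rat.
  by rewrite Num.Theory.pnatr_eq0 -lt0n fact_gt0.
suff -> : 2 * (n == 0%N)%:R = n`!%:R *
    fps_mul expt_add1 (fun i => euler i / i`!%:R) n :> rat.
  rewrite /fps_mul mulr_sumr /expt_add1.
  under [RHS]eq_bigr do rewrite mulrDl mulrDr.
  rewrite big_split addrC /=; congr (_ + _).
    rewrite [LHS](reindex_inj rev_ord_inj) /=; apply: eq_bigr => i _.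
    have lein : (i <= n)%N by rewrite -ltnS.
    rewrite subSS bin_sub // -mulr_natl -(bin_fact lein) !natrM.
    by field; rewrite !fact_neq0.
  rewrite big_ord_recl big1 /= ?addr0 ?subn0.
    by rewrite mul1r mulrCA divff // mulr1.
  by move=> i _; rewrite mul0r mulr0.
by rewrite euler_gf; case: n => [|n] /=; rewrite ?mulr0 // fact0 mul1r.
Qed.

(** * Moments of 1 - x under the fermionic integral *)

Section FermionicMoments.
Variables (p : nat) (p_pr : prime p).
Hypothesis p_odd : odd p.
Local Notation Zp := (padicint p_pr).
Local Notation Qp := (padic p_pr).
Local Notation ball := (padic_ball p_pr).
Local Notation iota := (@padic_of_int p p_pr).
Local Notation E n := (ratr (euler n) : Qp).

Lemma padic_euler_rec n :
  E n + \sum_(i < n.+1) E i *+ 'C(n, i) = 2 * (n == 0%N)%:R.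
Proof.
have qpD := ratrD_char0 _ (@padic_natr_neq0 p p_pr).
have qpM := ratrM_char0 _ (@padic_natr_neq0 p p_pr).
have := congr1 (fun x : rat => ratr x : Qp) (euler_rec n).
rewrite /= qpD (qpM 2) !ratr_nat => <-; congr (_ + _).
rewrite (big_morph _ qpD (ratr_nat _ 0)); apply: eq_bigr => i _.
by rewrite -[in RHS]mulr_natr qpM ratr_nat mulr_natr.
Qed.

Lemma padic_ballM N x z : ball N x -> ball N (x * iota z).
Proof. by move=> [t ->]; exists (t * z); rewrite rmorphM mulrA. Qed.

Lemma padic_ball_nat N x n : ball N x -> ball N (x *+ n).
Proof. by rewrite -mulr_natr -(rmorph_nat iota); exact: padic_ballM. Qed.

Lemma padic_ball0 N : ball N 0.
Proof. by exists 0; rewrite rmorph0 mulr0. Qed.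

Lemma padic_ball_sum N I (r : seq I) (P : pred I) (F : I -> Qp) :
  (forall i, P i -> ball N (F i)) -> ball N (\sum_(i <- r | P i) F i).
Proof.
by move=> h; apply: big_ind => //; [exact: padic_ball0 | exact: padic_ballD].
Qed.

(** The residue of 1/2 modulo p^n is (p^n + 1)/2. Coherence is (p^(n+1) + 1)/2 = ((p - 1)/2) p^n +
    (p^n + 1)/2. *)
Lemma half_padicint : exists h : Zp, 2 * h = 1.
Proof.
have coh n : ((p ^ n.+1).+1./2 = (p ^ n).+1./2 %[mod p ^ n])%N.
  have e j : (p ^ j).+1./2 = (p ^ j)./2.+1 by rewrite -uphalfE uphalf_half oddX p_odd orbT.
  have d j : (p ^ j = (p ^ j)./2.*2.+1)%N.
    by rewrite -[LHS]odd_double_half oddX p_odd orbT.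
  have -> : ((p ^ n.+1).+1./2 = p./2 * p ^ n + (p ^ n).+1./2)%N.
    by rewrite !e; move: (d n) (d n.+1) (d 1%N); rewrite expn1 expnS; nia.
  by rewrite modnMDl.
exists (mk_padicint p_pr coh); apply: padicint_eq => n.
rewrite presM -[2]/(2%:R) -[1]/(1%:R) !pres_nat modnMml /= modnMmr.
rewrite mul2n uphalf_half oddX p_odd orbT /= add1n doubleS.
have -> : ((p ^ n)./2.*2.+2 = (p ^ n) + 1)%N.
  by rewrite -[in RHS](odd_double_half (p ^ n)) oddX p_odd orbT addn1 add1n.
by rewrite modnDl.
Qed.

Lemma padic_ball_half N x : ball N (x *+ 2) -> ball N x.
Proof.
have [h h2] := half_padicint; move=> /(padic_ballM _ _ h).
by rewrite -mulr_natr -(rmorph_nat iota) -mulrA -rmorphM h2 rmorph1 mulr1.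
Qed.

(** The term i = n of the sum doubles [u n], and the earlier terms lie in the ball by strong
    induction; division by 2 preserves the ball. *)
Lemma padic_ball_euler_rec N (u : nat -> Qp) :
  (forall n, ball N (u n + \sum_(i < n.+1) u i *+ 'C(n, i))) ->
  forall n, ball N (u n).
Proof.
move=> hu; elim/ltn_ind => n IHn; apply: padic_ball_half.
have := hu n; rewrite big_ord_recr /= binn mulr1n addrCA -mulr2n => h.
set s := \sum_(i < n) _ in h.
rewrite -[_ *+ 2](addKr s) addrC; apply: padic_ballD => //; apply: padic_ballN.
by apply: padic_ball_sum => i _; apply: padic_ball_nat; exact: IHn.
Qed.

Lemma fermionic_sum_shift (f : nat -> Qp) M : odd M ->
  \sum_(0 <= x < M) f x.+1 * (-1) ^+ x + \sum_(0 <= x < M) f x * (-1) ^+ x =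
  f 0%N + f M.
Proof.
move=> M_odd; rewrite -big_split /=.
(* Consecutive signs are opposite, so each summand is a difference of this function; oddness of [M]
   gives [f M] the sign +. *)
rewrite (telescope_sumr_eq (fun x => - ((-1) ^+ x * f x))) //.
  by rewrite -signr_odd M_odd expr0 expr1; ring.
by move=> x _; rewrite exprS; ring.
Qed.

(** The correction at s = 0 is forced: an odd number of alternating signs sums to 1, and E_0 = 1. *)
Lemma fermionic_moment_1sub N s :
  ball N (fermionic_sum (fun x : Zp => (1 - iota x) ^+ s) N -
          (2 + E s - 2 * (s == 0%N)%:R)).
Proof.
set b := fun s => fermionic_sum (fun x : Zp => (1 - iota x) ^+ s) N.
pose e s := 2 + E s - 2 * (s == 0%N)%:R.
apply: (padic_ball_euler_rec N (fun s => b s - e s)) => {}s.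
have b_rec : b s + \sum_(i < s.+1) b i *+ 'C(s, i) =
    2 ^+ s + (2 - (p ^ N)%:R) ^+ s.
  have M_odd : odd (p ^ N) by rewrite oddX p_odd orbT.
  have := fermionic_sum_shift (fun x => (2 - x%:R) ^+ s) _ M_odd.
  rewrite subr0 => <-; congr (_ + _).
    by apply: eq_bigr => x _; rewrite rmorph_nat -natr1; congr (_ ^+ _ * _); ring.
  under eq_bigr do rewrite /b /fermionic_sum -sumrMnl.
  rewrite exchange_big; apply: eq_bigr => x _.
  (* The shifted sum was [b s] itself; the unshifted one expands binomially into all [b i] with i <=
     s. *)
  have -> : 2 - x%:R = (1 - x%:R) + 1 :> Qp by ring.
  rewrite exprD1n mulr_suml; apply: eq_bigr => i _.
  by rewrite rmorph_nat mulrnAl.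
have e_rec : e s + \sum_(i < s.+1) e i *+ 'C(s, i) = 2 ^+ s + 2 ^+ s.
  have sum_bin : \sum_(i < s.+1) 2 *+ 'C(s, i) = 2 * 2 ^+ s :> Qp.
    have := exprD1n (1 : Qp) s; rewrite -[1 + 1]/2 => ->.
    by rewrite mulr_sumr; apply: eq_bigr => i _; rewrite expr1n mulrnAr mulr1.
  have sum_0 : \sum_(i < s.+1) (2 * (nat_of_ord i == 0%N)%:R) *+ 'C(s, i) = 2 :> Qp.
    rewrite big_ord_recl big1 ?addr0 /= ?mulr1 ?bin0 //.
    by move=> i _; rewrite mulr0 mul0rn.
  under eq_bigr do rewrite /e mulrnBl mulrnDl.
  rewrite sumrB big_split /= sum_bin sum_0 /e.
  by have := padic_euler_rec s; set t := \sum_(i < _) _ => h; rewrite -h; ring.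
have -> : b s - e s + \sum_(i < s.+1) (b i - e i) *+ 'C(s, i) =
    (2 - (p ^ N)%:R) ^+ s - 2 ^+ s.
  under eq_bigr do rewrite mulrnBl.
  by rewrite sumrB addrACA -opprD b_rec e_rec; ring.
(* The difference of powers is (2 - p^N) - 2 = -p^N times an integral cofactor, whose negative is
   the witness. *)
rewrite subrXX; exists (- \sum_(i < s) (2 - (p ^ N)%:R) ^+ (s.-1 - i) * 2 ^+ i).
rewrite rmorphN rmorph_sum mulrN -mulNr natrX; congr (_ * _); first by ring.
by apply: eq_bigr => i _; rewrite rmorphM !rmorphXn rmorphB rmorphXn !rmorph_nat.
Qed.

Lemma fermionic_integralE (f : Zp -> Qp) (l : Qp) :
  (forall N, ball N (fermionic_sum f N - l)) ->
  fermionic_integrable f /\ fermionic_integral f = l.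
Proof.
move=> fl; have cvl : (fermionic_sum f @ \oo --> l)%classic.
  by apply/padic_cvgP => N; exists N => M NM; exact: padic_ball_le (fl M).
by split; [apply/cvg_ex; exists l | apply: cvg_lim cvl; exact: padic_hausdorff].
Qed.


(** Coefficients are taken in Z_p so that multiplying by them keeps each moment error in the ball
    p^N Z_p. *)
Lemma fermionic_integral_1sub_poly d (c : nat -> Zp) (s : nat -> nat) :
  let f (x : Zp) := \sum_(0 <= j < d) iota (c j) * (1 - iota x) ^+ s j in
  fermionic_integrable f /\
  fermionic_integral f =
    \sum_(0 <= j < d) iota (c j) * (2 + E (s j) - 2 * (s j == 0%N)%:R).
Proof.
move=> f; apply: fermionic_integralE => N.
have -> : fermionic_sum f N = \sum_(0 <= j < d) iota (c j) *
    fermionic_sum (fun x : Zp => (1 - iota x) ^+ s j) N.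
  rewrite /fermionic_sum; under eq_bigr do rewrite mulr_suml.
  rewrite exchange_big; apply: eq_bigr => j _; rewrite mulr_sumr.
  by apply: eq_bigr => x _; rewrite mulrA.
rewrite -sumrB; apply: padic_ball_sum => j _; rewrite -mulrBr mulrC.
by apply: padic_ballM; exact: fermionic_moment_1sub.
Qed.

End FermionicMoments.

(** * Products of Bernstein polynomials *)

Lemma horner_bernstein (R : comNzRingType) (k n : nat) (x : R) :
  (bernstein R k n).[x] = 'C(n, k)%:R * (x ^+ k * (1 - x) ^+ (n - k)).
Proof.
rewrite /bernstein; case: leqP => [_|ltnk]; last first.
  by rewrite bin_small // horner0 mul0r.
by rewrite hornerZ !hornerE.
Qed.

Lemma bernstein_mul_1sub (R : comNzRingType) (k n m : nat) (x : R) :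
  (bernstein R k n).[x] * (bernstein R k m).[x] =
  \sum_(0 <= j < (2 * k).+1)
    ('C(n, k)%:R * 'C(m, k)%:R * ('C(2 * k, j)%:R * (-1) ^+ (j + 2 * k))) *
    (1 - x) ^+ (n + m - j).
Proof.
rewrite !horner_bernstein.
(* If k exceeds n or m, a binomial coefficient kills both sides; otherwise the truncated
   subtractions below are genuine. *)
have [kn|ltnk] := leqP k n; last first.
  by rewrite bin_small // !mul0r big1 // => j _; rewrite !mul0r.
have [km|ltmk] := leqP k m; last first.
  by rewrite (bin_small ltmk) mul0r !mulr0 big1 // => j _; rewrite !mul0r.
have x2k : x ^+ k * x ^+ k =
    \sum_(j < (2 * k).+1) ((-1) ^+ j * (1 - x) ^+ (2 * k - j)) *+ 'C(2 * k, j).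
  (* The base is -x, and the even exponent removes the sign. *)
  transitivity ((1 - x - 1) ^+ (2 * k)).
    by rewrite -exprD addnn -mul2n !exprM; congr (_ ^+ _); ring.
  by rewrite exprBn; apply: eq_bigr => j _; rewrite expr1n mulr1.
transitivity ('C(n, k)%:R * 'C(m, k)%:R *
    ((x ^+ k * x ^+ k) * ((1 - x) ^+ (n - k) * (1 - x) ^+ (m - k)))).
  by ring.
rewrite x2k -exprD mulr_suml mulr_sumr big_mkord; apply: eq_bigr => j _.
have -> : (n + m - j = (2 * k - j) + (n - k + (m - k)))%N.
  by have := ltn_ord j; lia.
rewrite (exprD (-1)) (exprM (-1)) (exprD (1 - x) (2 * k - j)) sqrrN !expr1n mulr1.
by rewrite -[(_ * _) *+ _]mulr_natr; ring.
Qed.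

Theorem theorem5 (p : nat) (p_pr : prime p) (p_odd : odd p) (m n k : nat)
    (mn_gt : (2 * k < m + n)%N) :
  let f (x : padicint p_pr) : padic p_pr :=
    (bernstein (padic p_pr) k n).[padic_of_int x] *
    (bernstein (padic p_pr) k m).[padic_of_int x] in
  fermionic_integrable f /\
  fermionic_integral f =
    if k == 0%N then 2 + ratr (euler (n + m))
    else 'C(n, k)%:R * 'C(m, k)%:R *
         \sum_(0 <= j < (2 * k).+1)
           'C(2 * k, j)%:R * (-1) ^+ (j + 2 * k) * ratr (euler (n + m - j)).
Proof.
move=> f.
pose c j : padicint p_pr :=
  'C(n, k)%:R * 'C(m, k)%:R * ('C(2 * k, j)%:R * (-1) ^+ (j + 2 * k)).
have cE j : padic_of_int (c j) =
    'C(n, k)%:R * 'C(m, k)%:R * ('C(2 * k, j)%:R * (-1) ^+ (j + 2 * k)).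
  by rewrite !rmorphM !rmorph_nat rmorphXn rmorphN1.
have -> : f = fun x => \sum_(0 <= j < (2 * k).+1)
    padic_of_int (c j) * (1 - padic_of_int x) ^+ (n + m - j).
  apply: funext => x; rewrite /f bernstein_mul_1sub.
  by apply: eq_bigr => j _; rewrite cE.
have [int_f ->] :=
  fermionic_integral_1sub_poly p p_pr p_odd (2 * k).+1 c (fun j => n + m - j)%N.
(* This alternating sum multiplies the constant 2 of the moments; it is (1 - 1)^(2k), nonzero only
   for k = 0. *)
split=> //; have alt_bin : \sum_(0 <= j < (2 * k).+1)
    'C(2 * k, j)%:R * (-1) ^+ (j + 2 * k) = (k == 0%N)%:R :> padic p_pr.
  have <- : (1 - 1) ^+ (2 * k) = (k == 0%N)%:R :> padic p_pr.
    by rewrite subrr expr0n muln_eq0.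
  rewrite exprBn big_mkord; apply: eq_bigr => j _.
  by rewrite (exprD (-1)) (exprM (-1)) sqrrN !expr1n !mulr1 mulr_natl.
transitivity ('C(n, k)%:R * 'C(m, k)%:R * (2 * (k == 0%N)%:R +
    \sum_(0 <= j < (2 * k).+1)
      'C(2 * k, j)%:R * (-1) ^+ (j + 2 * k) * ratr (euler (n + m - j))
    : padic p_pr)).
  rewrite -alt_bin mulr_sumr -big_split mulr_sumr.
  apply: eq_big_nat => j /andP[_ lej]; rewrite cE.
  (* Since j <= 2k < m + n, only positive exponents occur and the correction at exponent 0 never
     enters. *)
  have /negbTE -> : (n + m - j)%N != 0%N by lia.
  by rewrite mulr0 subr0 /=; ring.
case: (eqVneq k 0%N) => [-> |_] /=; last by rewrite mulr0 add0r.
by rewrite muln0 big_nat1 !bin0 subn0 !mulr1 !mul1r.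
Qed.
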